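(* Let $G$ be a finite simple graph containing an asteroidal triple. Then $R_G$ is not F-pure in any positive characteristic, i.e. for every prime $p$ and every base field $\Bbbk$ of characteristic $p$, the ring $R_G$ is not F-pure. In particular, the following assertion is false: ''for every finite simple graph $G$, with $p$ denoting the characteristic of the base field, $R_G$ is F-pure for all sufficiently large $p>0$.''
   Context: Graphs are finite and simple. For a graph $G$ on vertex set $[n]=\{1,\dots,n\}$ and a field $\Bbbk$, let $R=\Bbbk[x_1,\dots,x_n,y_1,\dots,y_n]$ and $f_{i,j}=x_iy_j-x_jy_i$. The binomial edge ideal of $G$ is $J_G=(f_{i,j}\mid \{i,j\}\in E(G))\subseteq R$, and $R_G=R/J_G$. Three (distinct) vertices of a graph form an asteroidal triple if any two of them are connected by a path avoiding the neighborhood of the third, where the neighborhood of $v$ is $N_G(v)=\{u\in V(G)\mid \{u,v\}\in E(G)\}$. A ring $A$ of prime characteristic $p>0$ is F-pure if the Frobenius map $F:A\to F_*A$, $r\mapsto F_*r^p$, is a pure map of $A$-modules, i.e. $M\to M\otimes_A F_*A$ is injective for every $A$-module $M$. Here $F_*A$ is $A$ regarded as an $A$-module via $r\cdot F_*s=F_*(r^ps)$. *)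

(* Defs.v *)
From HB Require Import structures.
From mathcomp Require Import all_boot all_order all_algebra.
From mathcomp Require Import ring_quotient.
From mathcomp Require Import boolp freeg mpoly.

Set Implicit Arguments.
Unset Strict Implicit.
Unset Printing Implicit Defensive.

Import GRing.Theory.
Local Open Scope ring_scope.
Local Open Scope quotient_scope.

(* The vertex set is {0, ..., n-1}. *)
Record sgraph (n : nat) := SGraph {
  adj :> rel 'I_n;
  adj_sym : ssrbool.symmetric adj;
  adj_irr : irreflexive adj }.

Section AsteroidalTriple.
Variables (n : nat) (G : sgraph n).

Definition neighborhood (v : 'I_n) : {set 'I_n} := [set u | G u v].

(* All vertices of the path, end points included, must avoid N(w). *)
Definition connected_avoiding (w u v : 'I_n) : Prop :=
  exists s : seq 'I_n,
    [/\ path G u s, last u s = v, uniq (u :: s)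
      & all (fun x => x \notin neighborhood w) (u :: s)].

Definition asteroidal_triple (a b c : 'I_n) : Prop :=
  uniq [:: a; b; c] /\
  [/\ connected_avoiding c a b, connected_avoiding a b c
    & connected_avoiding b a c].

Definition has_asteroidal_triple : Prop :=
  exists a b c : 'I_n, asteroidal_triple a b c.

End AsteroidalTriple.

Section BinomialEdgeIdeal.
Variables (n : nat) (G : sgraph n) (k : fieldType).

(* The first n of the n + n variables are the x_i, the last n the y_i. *)
Definition xvar (i : 'I_n) : {mpoly k[n + n]} := 'X_(lshift n i).
Definition yvar (i : 'I_n) : {mpoly k[n + n]} := 'X_(rshift n i).

Definition edge_binomial (i j : 'I_n) : {mpoly k[n + n]} :=
  xvar i * yvar j - xvar j * yvar i.

(* Each edge is counted in both orientations, which is harmless since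
   f_{j,i} = - f_{i,j}. *)
Definition in_binomial_edge_ideal (q : {mpoly k[n + n]}) : Prop :=
  exists c : 'I_n -> 'I_n -> {mpoly k[n + n]},
    q = \sum_(i < n) \sum_(j < n | G i j) c i j * edge_binomial i j.

Definition binomial_edge_ideal : pred {mpoly k[n + n]} :=
  fun q => `[< in_binomial_edge_ideal q >].

Lemma binomial_edge_ideal_closed : idealr_closed binomial_edge_ideal.
Proof.
split.
- apply/asboolP; exists (fun _ _ => 0).
  by rewrite big1 // => i _; rewrite big1 // => j _; rewrite mul0r.
- apply/negP => /asboolP [c /(congr1 (fun q => q.@[fun=> 0]))].
  rewrite rmorph1 rmorph_sum big1 => [/eqP|i _]; first by rewrite oner_eq0.
  rewrite rmorph_sum big1 // => j _.
  by rewrite rmorphM rmorphB !rmorphM /= !mevalXU !mulr0 subr0 mulr0.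
- move=> a u v /asboolP[c ->] /asboolP[d ->].
  apply/asboolP; exists (fun i j => a * c i j + d i j).
  rewrite mulr_sumr -big_split; apply: eq_bigr => i _ /=.
  rewrite mulr_sumr -big_split; apply: eq_bigr => j _ /=.
  by rewrite mulrDl mulrA.
Qed.

HB.instance Definition _ :=
  isIdealr.Build {mpoly k[n + n]} binomial_edge_ideal
    binomial_edge_ideal_closed.

Definition binomial_edge_ring : comNzRingType :=
  {ideal_quot (binomial_edge_ideal : idealr _)}.

Lemma pchar_binomial_edge_ring (p : nat) :
  p \in [pchar k] -> p \in [pchar binomial_edge_ring].
Proof.
move=> pk; rewrite inE (pcharf_prime pk) /=; apply/eqP.
rewrite -(rmorph_nat (\pi_{ideal_quot (binomial_edge_ideal : idealr _)})).
by rewrite -(rmorph_nat (@mpolyC (n + n) k)) (pcharf0 pk) !rmorph0.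
Qed.

End BinomialEdgeIdeal.

Section Tensor.
Variables (A : comNzRingType) (M N : lmodType A).

Definition pair_group : zmodType := {freeg (M * N)%type / int}.

(* The subgroup of Z^(M x N) generated by the relations of bilinearity and
   A-balancedness. *)
Inductive tensor_relation : pair_group -> Prop :=
| TensorRel0 : tensor_relation 0
| TensorRelB d1 d2 :
    tensor_relation d1 -> tensor_relation d2 -> tensor_relation (d1 - d2)
| TensorRelDl (x1 x2 : M) (y : N) :
    tensor_relation (<< (x1 + x2, y) >> - << (x1, y) >> - << (x2, y) >>)
| TensorRelDr (x : M) (y1 y2 : N) :
    tensor_relation (<< (x, y1 + y2) >> - << (x, y1) >> - << (x, y2) >>)
| TensorRelZ (a : A) (x : M) (y : N) :
    tensor_relation (<< (a *: x, y) >> - << (x, a *: y) >>).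

Definition tensor_kernel : pred pair_group :=
  fun d => `[< tensor_relation d >].

Lemma tensor_kernel_closed : zmod_closed tensor_kernel.
Proof.
split; first by apply/asboolP; exact: TensorRel0.
by move=> d1 d2 /asboolP h1 /asboolP h2; apply/asboolP; exact: TensorRelB.
Qed.

HB.instance Definition _ :=
  GRing.isZmodClosed.Build pair_group tensor_kernel
    tensor_kernel_closed.

(* Only the underlying abelian group of the tensor product is constructed: the
   module structure plays no role in the injectivity of a map into it. *)
Definition tensor : Type :=
  {ideal_quot (GRing.ZmodClosed.clone pair_group tensor_kernel _)}.

HB.instance Definition _ := Choice.on tensor.
HB.instance Definition _ := Quotient.on tensor.
HB.instance Definition _ := ZmodQuotient.on tensor.

Definition tmul (x : M) (y : N) : tensor := \pi_tensor << (x, y) >>.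

End Tensor.

Section Frobenius.
Variables (A : comNzRingType) (p : nat) (pA : p \in [pchar A]).

(* F_* A; the characteristic hypothesis is a phantom parameter on which the
   module structure depends. *)
Definition Fpush of p \in [pchar A] : Type := A.

HB.instance Definition _ := GRing.Zmodule.copy (Fpush pA) A.

Definition Fpush_scale (r : A) (s : Fpush pA) : Fpush pA := r ^+ p * (s : A).

Fact Fpush_scaleA a b v :
  Fpush_scale a (Fpush_scale b v) = Fpush_scale (a * b) v.
Proof. by rewrite /Fpush_scale exprMn mulrA. Qed.

Fact Fpush_scale1 : left_id 1 Fpush_scale.
Proof. by move=> v; rewrite /Fpush_scale expr1n mul1r. Qed.

Fact Fpush_scaleDr : right_distributive Fpush_scale +%R.
Proof. by move=> a u v; exact: mulrDr. Qed.

Fact Fpush_scaleDl v : {morph Fpush_scale^~ v : a b / a + b}.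
Proof.
move=> a b; rewrite /Fpush_scale -!(pFrobenius_autE pA).
by rewrite (pFrobenius_autD_comm pA (mulrC a b)); exact: mulrDl.
Qed.

HB.instance Definition _ :=
  GRing.Zmodule_isLmodule.Build A (Fpush pA)
    Fpush_scaleA Fpush_scale1 Fpush_scaleDr Fpush_scaleDl.

(* The map M -> M (x)_A F_* A is obtained from the Frobenius A -> F_* A by
   tensoring with M and identifying M with M (x)_A A, hence sends m to
   m (x) F_*(1^p) = m (x) F_* 1. *)
Definition tensor_Frobenius (M : lmodType A) (m : M) : tensor M (Fpush pA) :=
  tmul m ((1 : A) : Fpush pA).

Definition F_pure : Prop :=
  forall M : lmodType A, injective (@tensor_Frobenius M).

End Frobenius.

(* Main.v *)
Require Import Defs.
From HB Require Import structures.
From mathcomp Require Import all_boot all_order all_algebra.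
From mathcomp Require Import ring_quotient.
From mathcomp Require Import boolp mpoly ring.

(** Write D_w for the product of the x_v over the vertices v outside N(w).  If
    u and v are joined by a path avoiding N(w), the Plücker relation
    [x_w f_uv = x_u f_wv + x_v f_uw], iterated along the path, shows that
    [D_w f_uv] lies in J_G ([avoiding_prod_binomial_in]).  For an asteroidal
    triple a, b, c, the annihilators I_a, I_b, I_c of D_a, D_b, D_c in R_G
    therefore contain f_bc, f_ac and f_ab respectively.

    In an F-pure ring annihilators satisfy the distributive law
    [I_c \cap (I_a + I_b) = I_c \cap I_a + I_c \cap I_b]
    ([F_pure_annihilator_distr]): if [u = r + s], then
    [u^p = u^(p-1) r + u^(p-1) s] is a decomposition of the required kind for
    u^p, and a finite system of linear equations over A with right-hand sides
    in A that becomes solvable in F_*A is already solvable in A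
    ([F_pure_solve]).

    The law fails in R_G.  Applied to
    [x_c f_ab = x_b f_ac - x_a f_bc], which lies in I_c and in I_a + I_b, it
    would produce q in I_a and I_c with x_c f_ab - q in I_b and I_c.
    Geometrically, restrict to the 6-dimensional space where only the points
    (x_v, y_v) with v = a, b, c may be nonzero: elements of I_c vanish where
    the points of a and b are proportional, and similarly for I_a and I_b.  So
    q would restrict to a multiple of f_ab f_bc, and the other summand to a
    multiple of f_ab f_ac; neither has terms of degree 1 in each of the three
    points, while x_c f_ab has nothing else.  The proof compares the
    coefficients of x_a y_b x_c and y_a x_b x_c: the latter is 0 in q because
    q is in I_a, the former is 0 in x_c f_ab - q because this is in I_b, and in
    q the two add up to 0 because q is in I_c; but the former is 1 in x_c f_ab
    ([colon_split_impossible]).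

    The 6-cycle has an asteroidal triple, so its ring is F-pure in no
    characteristic. *)

Set Implicit Arguments.
Unset Strict Implicit.
Unset Printing Implicit Defensive.

Import GRing.Theory.
Local Open Scope ring_scope.
Local Open Scope quotient_scope.

(** * Purity and linear equations *)

Section CyclicQuotient.
Variables (A : comNzRingType) (V : lmodType A) (d : V).

Definition cyclic_submodule : pred V := fun v => `[< exists a, v = a *: d >].

Fact cyclic_submodule_closed : zmod_closed cyclic_submodule.
Proof.
split; first by apply/asboolP; exists 0; rewrite scale0r.
move=> v w /asboolP[a ->] /asboolP[b ->]; apply/asboolP.
by exists (a - b); rewrite scalerBl.
Qed.

HB.instance Definition _ :=
  GRing.isZmodClosed.Build V cyclic_submodule cyclic_submodule_closed.

Definition cyclic_quot : Type :=
  {ideal_quot (GRing.ZmodClosed.clone V cyclic_submodule _)}.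

HB.instance Definition _ := Choice.on cyclic_quot.
HB.instance Definition _ := Quotient.on cyclic_quot.
HB.instance Definition _ := ZmodQuotient.on cyclic_quot.

Lemma cyclic_quot_eq (v w : V) :
  (\pi_cyclic_quot v == \pi_cyclic_quot w) = (v - w \in cyclic_submodule).
Proof. by rewrite -Quotient.idealrBE. Qed.

Definition cyclic_quot_scale (a : A) (v : cyclic_quot) : cyclic_quot :=
  \pi_cyclic_quot (a *: repr v).

Lemma pi_scale a (v : V) :
  cyclic_quot_scale a (\pi_cyclic_quot v) = \pi_cyclic_quot (a *: v).
Proof.
apply/eqP; rewrite cyclic_quot_eq -scalerBr.
have /asboolP[b ->] : repr (\pi_cyclic_quot v) - v \in cyclic_submodule.
  by rewrite -cyclic_quot_eq reprK.
by apply/asboolP; exists (a * b); rewrite scalerA.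
Qed.

Fact cyclic_quot_scaleA a b v :
  cyclic_quot_scale a (cyclic_quot_scale b v) = cyclic_quot_scale (a * b) v.
Proof. by elim/quotW: v => v; rewrite (pi_scale b v) !pi_scale scalerA. Qed.

Fact cyclic_quot_scale1 : left_id 1 cyclic_quot_scale.
Proof. by elim/quotW => v; rewrite pi_scale scale1r. Qed.

Fact cyclic_quot_scaleDr : right_distributive cyclic_quot_scale +%R.
Proof.
move=> a; elim/quotW => v; elim/quotW => w.
by rewrite -raddfD !pi_scale -raddfD scalerDr.
Qed.

Fact cyclic_quot_scaleDl v : {morph cyclic_quot_scale^~ v : a b / a + b}.
Proof.
by elim/quotW: v => v a b; rewrite !pi_scale -raddfD scalerDl.
Qed.

HB.instance Definition _ :=
  GRing.Zmodule_isLmodule.Build A cyclic_quot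
    cyclic_quot_scaleA cyclic_quot_scale1
    cyclic_quot_scaleDr cyclic_quot_scaleDl.

Lemma pi_cyclic_quotZ a (v : V) :
  \pi_cyclic_quot (a *: v) = a *: (\pi_cyclic_quot v : cyclic_quot).
Proof. by rewrite -pi_scale. Qed.

End CyclicQuotient.

Section TensorRelations.
Variables (A : comNzRingType) (M N : lmodType A).

Lemma tmulDl (x1 x2 : M) (y : N) : tmul (x1 + x2) y = tmul x1 y + tmul x2 y.
Proof.
rewrite /tmul -raddfD; apply/eqP; rewrite -Quotient.idealrBE opprD addrA.
by apply/asboolP; exact: TensorRelDl.
Qed.

Lemma tmulZ a (x : M) (y : N) : tmul (a *: x) y = tmul x (a *: y).
Proof.
apply/eqP; rewrite -Quotient.idealrBE.
by apply/asboolP; exact: TensorRelZ.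
Qed.

Lemma tmul0l (y : N) : tmul (0 : M) y = 0.
Proof. by apply: (@addrI _ (tmul (0 : M) y)); rewrite -tmulDl !addr0. Qed.

Lemma tmul_suml I (r : seq I) (F : I -> M) (y : N) :
  tmul (\sum_(i <- r) F i) y = \sum_(i <- r) tmul (F i) y.
Proof. by elim/big_rec2: _ => [|i z x _ <-]; rewrite ?tmul0l ?tmulDl. Qed.

End TensorRelations.

(** Test purity on M = A^m / A d.  The class of e is killed in the tensor
    product M (x) F_*A, since there [e (x) 1 = d (x) s]; hence it is 0 in M. *)
Lemma F_pure_solve (A : comNzRingType) (p : nat) (pA : p \in [pchar A])
    (m : nat) (d e : 'I_m -> A) (s : A) :
  F_pure pA -> (forall i, d i ^+ p * s = e i ^+ p) ->
  exists t, forall i, t * d i = e i.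
Proof.
move=> pureA ds.
pose dv := \row_i d i; pose ev := \row_i e i.
pose Q := cyclic_quot dv; pose N := Fpush pA.
pose pi : 'rV[A]_m -> Q := \pi_(cyclic_quot dv).
have tE (v : 'rV[A]_m) (y : N) :
    tmul (pi v) y = \sum_i tmul (pi (delta_mx 0 i)) (v 0 i *: y).
  rewrite [in LHS](row_sum_delta v) /pi raddf_sum tmul_suml.
  by apply: eq_bigr => i _; rewrite -tmulZ -pi_cyclic_quotZ.
have pid0 : pi dv = 0.
  rewrite -[0](raddf0 \pi_(cyclic_quot dv)); apply/eqP.
  rewrite cyclic_quot_eq subr0; apply/asboolP.
  by exists 1; rewrite scale1r.
have e0 : tensor_Frobenius pA (pi ev) = tensor_Frobenius pA 0.
  transitivity (tmul (pi dv) (s : N)); last first.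
    by rewrite pid0 /tensor_Frobenius !tmul0l.
  (* Expanded over the standard basis, e (x) 1 and d (x) s become the sums of
     the delta_i (x) e_i^p and of the delta_i (x) d_i^p s. *)
  rewrite /tensor_Frobenius !tE; apply: eq_bigr => i _; congr tmul.
  rewrite !mxE [LHS]mulr1; exact/esym/ds.
move: (pureA _ _ _ e0) => /eqP.
rewrite -[0](raddf0 \pi_(cyclic_quot dv)) cyclic_quot_eq subr0.
case/asboolP => t /rowP evE; exists t => i.
by have := evE i; rewrite !mxE.
Qed.

(** This is the distributive law
    [Ann c \cap (Ann a + Ann b) = Ann c \cap Ann a + Ann c \cap Ann b] for the
    element r + s: its two summands are t and r + s - t. *)
Lemma F_pure_annihilator_distr (A : comNzRingType) (p : nat)
    (pA : p \in [pchar A]) (a b c r s : A) :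
    F_pure pA -> a * s = 0 -> b * r = 0 -> c * (r + s) = 0 ->
  exists t, [/\ a * t = 0, b * (r + s - t) = 0 & c * t = 0].
Proof.
move=> pureA as0 br0 cu0.
have p_gt1 : (1 < p)%N by rewrite prime_gt1 ?(pcharf_prime pA).
set u := r + s in cu0 *.
(* In F_*A the unknown t is replaced by u^(p-1) s.  It is killed by c^p
   because p > 1 leaves a factor u, which c kills. *)
have [|t tE] := @F_pure_solve _ _ _ 3
  (fun i => [:: a; b; c]`_i) (fun i => [:: 0; b * u; 0]`_i)
  (u ^+ p.-1 * s) pureA.
  case: p p_gt1 {pA pureA} => [|[|p]] // _ [[|[|[|i]]] Hi] //=.
  - by rewrite expr0n exprSr mulrACA as0 mulr0.
  - rewrite exprMn [u ^+ p.+2]exprSr {3}/u mulrDr mulrDr [b ^+ _]exprSr.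
    by rewrite [X in _ = X + _]mulrACA br0 mulr0 add0r.
  - rewrite expr0n [c ^+ _]exprSr [u ^+ _]exprS -mulrA.
    by rewrite [c * (_ * s)]mulrA [c * (u * _)]mulrA cu0 !mul0r mulr0.
exists t; split; first by rewrite mulrC (tE ord0).
- have /= := tE (inord 1); rewrite inordK //= => tbE.
  by rewrite mulrBr -tbE mulrC subrr.
- by rewrite mulrC (tE ord_max).
Qed.

(** * Coefficients and vanishing of variables *)

Section KillVariables.
Variables (N : nat) (k : fieldType) (Z : pred 'I_N).

Definition kill_vars (q : {mpoly k[N]}) : {mpoly k[N]} :=
  q \mPo [tuple if Z i then 0 else 'X_i | i < N].

Fact kill_vars_zmod_morphism : zmod_morphism kill_vars.
Proof. exact: comp_mpoly_is_additive. Qed.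

Fact kill_vars_monoid_morphism : monoid_morphism kill_vars.
Proof. by split=> [|q r]; rewrite /kill_vars ?rmorph1 ?rmorphM. Qed.

HB.instance Definition _ :=
  GRing.isZmodMorphism.Build _ _ kill_vars kill_vars_zmod_morphism.
HB.instance Definition _ :=
  GRing.isMonoidMorphism.Build _ _ kill_vars kill_vars_monoid_morphism.

Lemma kill_varsX i : kill_vars 'X_i = if Z i then 0 else 'X_i.
Proof. by rewrite /kill_vars comp_mpolyXU -tnth_nth tnth_mktuple. Qed.

Lemma mcoeff_kill_vars (m : 'X_{1..N}) q :
  (forall i, Z i -> m i = 0%N) -> (kill_vars q)@_m = q@_m.
Proof.
move=> Zm; rewrite {2}[q]mpolyE /kill_vars comp_mpolyEX !raddf_sum.
apply: eq_bigr => m' _; rewrite /= !mcoeffZ; congr (_ * _).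
rewrite comp_mpolyX.
have [/forallP Zm' | /forallPn[i]] := boolP [forall i, Z i ==> (m' i == 0%N)].
  rewrite mpolyXE_id; congr mcoeff; apply: eq_bigr => i _.
  rewrite tnth_mktuple; case: ifP => // Zi.
  by move/implyP: (Zm' i) => /(_ Zi)/eqP ->; rewrite !expr0.
rewrite negb_imply => /andP[Zi m'i].
rewrite (bigD1 i) //= tnth_mktuple Zi expr0n (negbTE m'i) mul0r mcoeff0 mcoeffX.
by case: eqP => // mm; rewrite mm Zm in m'i.
Qed.

End KillVariables.

Lemma mcoeff_mulX0 (N : nat) (k : fieldType) (i : 'I_N) (q : {mpoly k[N]})
    (m : 'X_{1..N}) :
  m i = 0%N -> ('X_i * q)@_m = 0.
Proof.
move=> mi; rewrite -(@mcoeff_kill_vars _ _ (pred1 i)) => [|j /eqP ->] //.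
by rewrite rmorphM /= kill_varsX /= eqxx mul0r mcoeff0.
Qed.

(** * The binomial edge ideal and its colon ideals *)

Section EdgeIdeal.
Variables (n : nat) (G : sgraph n) (k : fieldType).
Local Notation R := {mpoly k[n + n]}.
Local Notation J := (@binomial_edge_ideal n G k).
Local Notation x := (xvar k).
Local Notation y := (yvar k).
Local Notation f := (edge_binomial k).
Local Notation A := (binomial_edge_ring G k).
Local Notation pi := (\pi_{ideal_quot (J : idealr _)}).

Lemma edge_binomial_in i j : G i j -> f i j \in J.
Proof.
move=> Gij; apply/asboolP.
exists (fun i' j' => ((i' == i) && (j' == j))%:R).
rewrite (bigD1 i) //= (bigD1 j) //= !eqxx mul1r.
rewrite big1 => [|j' /andP[_ /negbTE ->]]; last by rewrite andbF mul0r.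
rewrite big1 ?addr0 // => i' /negbTE ->.
by rewrite big1 // => j' _; rewrite mul0r.
Qed.

Lemma ideal_morph0 (S : pzRingType) (phi : {rmorphism R -> S}) :
  (forall i j, G i j -> phi (f i j) = 0) -> forall q, q \in J -> phi q = 0.
Proof.
move=> phi0 q /asboolP[c ->].
rewrite raddf_sum big1 // => i _; rewrite raddf_sum big1 // => j Gij.
transitivity (phi (c i j) * phi (f i j)); first exact: rmorphM.
by rewrite phi0 // mulr0.
Qed.

(** Inverting the vertices of a path makes its end points proportional. *)
Lemma path_binomial_in u s :
  path G u s -> (\prod_(w <- s) x w) * f u (last u s) \in J.
Proof.
elim: s u => [|w s IHs] u /=.
  by move=> _; rewrite /edge_binomial subrr mulr0 rpred0.
case/andP=> Guw /IHs wsJ; rewrite big_cons.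
set v := last w s in wsJ *; set P := \prod_(_ <- _) _ in wsJ *.
have -> : x w * P * f u v = x u * (P * f w v) + (P * x v) * f u w.
  by rewrite /edge_binomial; ring.
by rewrite rpredD // idealMr // edge_binomial_in.
Qed.

(** Only the x-variables are used, so that [avoiding_prod w] survives when all
    the y-variables are set to 0. *)
Definition avoiding_prod w : R := \prod_(v | v \notin neighborhood G w) x v.

Lemma avoiding_prod_binomial_in w u v :
  connected_avoiding G w u v -> avoiding_prod w * f u v \in J.
Proof.
case=> s [us <-] /= /andP[_ s_uniq] /andP[_ /allP sN].
have -> : avoiding_prod w =
    \prod_(i | (i \notin neighborhood G w) && (i \notin s)) x i *
    \prod_(i <- s) x i.
  rewrite /avoiding_prod (bigID (mem s)) /= mulrC; congr (_ * _).
  rewrite big_uniq //; apply: eq_bigl => i.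
  by rewrite andb_idl // => /sN.
by rewrite -mulrA idealMr // path_binomial_in.
Qed.

(** The variables to be set to 0: x_v for v in N(w), and y_v for v in Y.  When Y
    contains every vertex but possibly w, the resulting linear subspace lies in
    the zero set of J_G: off w all points have direction (1, 0), and the
    neighbors of w are 0.  As D_w does not vanish on it, every q with D_w q in
    J_G does ([colon_kill]). *)
Definition cone_vars (Y : pred 'I_n) (w : 'I_n) (i : 'I_(n + n)) : bool :=
  match split i with inl v => v \in neighborhood G w | inr v => Y v end.

Lemma cone_varsx Y w v :
  cone_vars Y w (lshift n v) = (v \in neighborhood G w).
Proof. by rewrite /cone_vars (unsplitK (inl v)). Qed.

Lemma cone_varsy Y w v : cone_vars Y w (rshift n v) = Y v.
Proof. by rewrite /cone_vars (unsplitK (inr v)). Qed.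

Lemma kill_xvar Y w v :
  kill_vars (cone_vars Y w) (x v) = if v \in neighborhood G w then 0 else x v.
Proof. by rewrite kill_varsX cone_varsx. Qed.

Lemma kill_yvar Y w v :
  kill_vars (cone_vars Y w) (y v) = if Y v then 0 else y v.
Proof. by rewrite kill_varsX cone_varsy. Qed.

Lemma kill_avoiding_prod Y w : kill_vars (cone_vars Y w) (avoiding_prod w) != 0.
Proof.
rewrite rmorph_prod; apply/prodf_neq0 => v vN.
rewrite /= kill_xvar (negbTE vN); apply/eqP.
move=> /(congr1 (mcoeff U_(lshift n v))).
by rewrite mcoeffXU eqxx mcoeff0 => /eqP; rewrite oner_eq0.
Qed.

Lemma kill_edge (Y : pred 'I_n) w i j : (forall v, v != w -> Y v) -> G i j ->
  kill_vars (cone_vars Y w) (f i j) = 0.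
Proof.
move=> YP Gij; rewrite /edge_binomial rmorphB !rmorphM.
have xy0 u v : G u v ->
    kill_vars (cone_vars Y w) (x u) * kill_vars (cone_vars Y w) (y v) = 0.
  move=> Guv; rewrite kill_yvar.
  have [Yv | Yv] := boolP (Y v); first by rewrite mulr0.
  have /eqP vw : v == w by apply: contraNT Yv => /YP.
  by rewrite kill_xvar inE -vw Guv mul0r.
by rewrite !xy0 ?subrr // adj_sym.
Qed.

Lemma colon_kill w q :
  avoiding_prod w * q \in J -> kill_vars (cone_vars (predC1 w) w) q = 0.
Proof.
have kill0 i j := @kill_edge (predC1 w) w i j (fun _ h => h).
move/(@ideal_morph0 _ (kill_vars (cone_vars (predC1 w) w)) kill0) => /eqP.
by rewrite rmorphM mulf_eq0 (negbTE (kill_avoiding_prod _ _)) => /eqP.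
Qed.

(** The first-order variation when the common direction (1, 0) of the points
    other than w is tilted to (1, t).  The zero set of J_G contains these
    deformations of the subspace above, so elements of J_G, and the elements
    that D_w multiplies into J_G, vanish to first order in t there. *)
Definition tilt w (q : R) : R := \sum_(v | v != w) x v * q^`M(rshift n v).

Lemma tiltD w q r : tilt w (q + r) = tilt w q + tilt w r.
Proof.
by rewrite /tilt -big_split; apply: eq_bigr => v _; rewrite mderivD mulrDr.
Qed.

Lemma tilt0 w : tilt w 0 = 0.
Proof. by apply: (@addrI _ (tilt w 0)); rewrite -tiltD !addr0. Qed.

Lemma tiltB w q r : tilt w (q - r) = tilt w q - tilt w r.
Proof. by rewrite -[q in RHS](subrK r) [in RHS]tiltD addrK. Qed.

Lemma tiltM w q r : tilt w (q * r) = tilt w q * r + q * tilt w r.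
Proof.
rewrite /tilt mulr_suml mulr_sumr -big_split; apply: eq_bigr => v _ /=.
by rewrite mderivM; ring.
Qed.

Lemma tiltx w i : tilt w (x i) = 0.
Proof.
by apply: big1 => v _; rewrite mderivX mnm1E eq_lrshift scale0r mulr0.
Qed.

Lemma tilty w i : tilt w (y i) = if i == w then 0 else x i.
Proof.
have dy v : (y i)^`M(rshift n v) = (i == v)%:R.
  rewrite mderivX mnm1E eq_rshift; case: eqP => [<-|_]; last by rewrite scale0r.
  rewrite scale1r -[in RHS]mpolyX0; congr 'X_[_]; apply/mnmP => ?.
  by rewrite mnmBE subnn mnm0E.
case: eqP => [<-|/eqP iw].
  by apply: big1 => v vi; rewrite dy eq_sym (negbTE vi) mulr0.
rewrite /tilt (bigD1 i) //= dy eqxx mulr1 big1 ?addr0 // => v /andP[_ vi].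
by rewrite dy eq_sym (negbTE vi) mulr0.
Qed.

Lemma tilt_avoiding_prod w w' : tilt w (avoiding_prod w') = 0.
Proof.
apply: (big_ind (fun q => tilt w q = 0)) => [|q r q0 r0|i _]; last exact: tiltx.
  by apply: big1 => v _; rewrite -mpolyC1 mderivC mulr0.
by rewrite tiltM q0 r0 mul0r mulr0 addr0.
Qed.

Lemma kill_tilt_edge w i j : G i j ->
  kill_vars (cone_vars predT w) (tilt w (f i j)) = 0.
Proof.
move=> Gij; rewrite tiltB !tiltM !tiltx !tilty !mul0r !add0r.
have [iw|_] := eqVneq i w; have [jw|_] := eqVneq j w.
- by rewrite iw jw adj_irr in Gij.
- by rewrite mulr0 subr0 rmorphM [_ (x j)]kill_xvar inE -iw adj_sym Gij mulr0.
- rewrite mulr0 sub0r rmorphN rmorphM [_ (x i)]kill_xvar inE.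
  by rewrite -jw Gij mulr0 oppr0.
- by rewrite mulrC subrr rmorph0.
Qed.

Lemma kill_tilt_ideal w q :
  q \in J -> kill_vars (cone_vars predT w) (tilt w q) = 0.
Proof.
case/asboolP => c ->.
pose P r := kill_vars (cone_vars predT w) (tilt w r) = 0.
have P0 : P 0 by rewrite /P tilt0 rmorph0.
have PD r s : P r -> P s -> P (r + s).
  by rewrite /P tiltD rmorphD /= => -> ->; rewrite addr0.
apply: (big_ind P) => // i _; apply: (big_ind P) => // j Gij.
rewrite /P tiltM rmorphD !rmorphM /= kill_edge // kill_tilt_edge //.
by rewrite !mulr0 addr0.
Qed.

Lemma colon_kill_tilt w q :
  avoiding_prod w * q \in J -> kill_vars (cone_vars predT w) (tilt w q) = 0.
Proof.
move/(kill_tilt_ideal w) => /eqP; rewrite tiltM tilt_avoiding_prod mul0r add0r.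
by rewrite rmorphM mulf_eq0 (negbTE (kill_avoiding_prod _ _)) => /eqP.
Qed.

Local Notation X v := (U_(lshift n v))%MM.
Local Notation Y v := (U_(rshift n v))%MM.

(** The monomial y_w x_a x_b survives on the linear subspace of [colon_kill]. *)
Lemma mcoeff_colon w a b q : avoiding_prod w * q \in J ->
  a \notin neighborhood G w -> b \notin neighborhood G w -> a != w -> b != w ->
  q@_(Y w + X a + X b) = 0.
Proof.
move=> /colon_kill q0 /negbTE aN /negbTE bN /negbTE aw /negbTE bw.
rewrite -(@mcoeff_kill_vars _ _ (cone_vars (predC1 w) w)) ?q0 ?mcoeff0 // => i.
rewrite !mnmDE !mnm1E -(splitK i); case: (split i) => v.
  rewrite cone_varsx !eq_lshift eq_rlshift => vN.
  have [av|_] := eqVneq a v; first by rewrite av vN in aN.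
  by have [bv|_] := eqVneq b v; first by rewrite bv vN in bN.
by rewrite cone_varsy !eq_lrshift eq_rshift /= eq_sym => /negbTE ->.
Qed.

(** Tilting the direction turns both y_a x_b x_w and x_a y_b x_w into
    x_a x_b x_w, and no other monomial contributes to it. *)
Lemma mcoeff_colon_tilt w a b q : avoiding_prod w * q \in J ->
  a \notin neighborhood G w -> b \notin neighborhood G w ->
  a != w -> b != w -> a != b ->
  q@_(Y a + X b + X w) + q@_(Y b + X a + X w) = 0.
Proof.
move=> /colon_kill_tilt q0 /negbTE aN /negbTE bN aw bw ab.
have wN : w \in neighborhood G w = false by rewrite inE adj_irr.
have coefXd v (m : 'X_{1.. n + n}) : m (rshift n v) = 0%N ->
    (x v * q^`M(rshift n v))@_(X v + m) = q@_(m + Y v).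
  by move=> mv; rewrite /xvar mulrC mcoeffMX mcoeff_deriv mv.
have := congr1 (mcoeff (X a + X b + X w)) q0.
rewrite mcoeff0 mcoeff_kill_vars; last first.
  move=> i; rewrite !mnmDE !mnm1E -(splitK i); case: (split i) => v.
    rewrite cone_varsx !eq_lshift => vN.
    have [av|_] := eqVneq a v; first by rewrite av vN in aN.
    have [bv|_] := eqVneq b v; first by rewrite bv vN in bN.
    by have [wv|_] := eqVneq w v; first by rewrite -wv wN in vN.
  by rewrite !eq_lrshift.
rewrite raddf_sum (bigD1 a) //= (bigD1 b) /=; last by rewrite bw eq_sym.
rewrite big1 => [|v /andP[/andP[vw va] vb]]; last first.
  by rewrite mcoeff_mulX0 // !mnmDE !mnm1E !eq_lshift ![_ == v]eq_sym
     (negbTE va) (negbTE vb) (negbTE vw).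
have mE1 : (X a + X b + X w = X a + (X b + X w))%MM by rewrite addmA.
have mE2 : (X a + X b + X w = X b + (X a + X w))%MM.
  by rewrite [(X a + X b)%MM]addmC addmA.
rewrite addr0 {1}mE1 mE2 !coefXd; first last.
- by rewrite !mnmDE !mnm1E !eq_lrshift.
- by rewrite !mnmDE !mnm1E !eq_lrshift.
by rewrite [(X b + X w + _)%MM]addmC [(X a + X w + _)%MM]addmC !addmA.
Qed.

(** Three independent vertices a, b, c suffice for the contradiction: of the two
    coefficients that cancel in q by [mcoeff_colon_tilt], one is 0 since q is in
    I_a, and the other is that of x_c f_ab, namely 1. *)
Lemma colon_split_impossible a b c q :
    uniq [:: a; b; c] -> ~~ G a b -> ~~ G b c -> ~~ G a c ->
    avoiding_prod a * q \in J -> avoiding_prod c * q \in J ->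
  avoiding_prod b * (x c * f a b - q) \notin J.
Proof.
rewrite /= !inE negb_or => /and3P[/andP[ab ac] bc _] nGab nGbc nGac qa qc.
apply/negP => uqb.
have nbh u v : ~~ G u v ->
    ((u \notin neighborhood G v) * (v \notin neighborhood G u))%type.
  by move=> nG; rewrite !inE nG adj_sym.
have [[nab nbc] nac] := (nbh _ _ nGab, nbh _ _ nGbc, nbh _ _ nGac).
have qa0 : q@_(Y a + X b + X c) = 0.
  by rewrite (mcoeff_colon qa) ?nab ?nac // eq_sym.
have qc0 : q@_(Y b + X a + X c) = 0.
  have := mcoeff_colon_tilt qc; move/(_ a b).
  by rewrite nac nbc ac bc ab qa0 add0r; apply.
have := mcoeff_colon uqb; move/(_ a c); rewrite nab nbc ab eq_sym bc.
move=> /(_ isT isT isT isT) => /eqP.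
rewrite mcoeffB qc0 subr0 mulrBr mulrA mulrA /xvar /yvar -!mpolyXD.
rewrite mcoeffB !mcoeffX.
have -> : (X c + X a + Y b)%MM = (Y b + X a + X c)%MM.
  by rewrite [RHS]addmC [(Y b + X a)%MM]addmC addmA.
rewrite eqxx.
case: (_ =P _ :> 'X_{1..n + n}) => [mE|_]; last by rewrite subr0 oner_eq0.
have := congr1 (fun m : 'X_{1..n + n} => m (rshift n a)) mE.
by rewrite !mnmDE !mnm1E !eq_lrshift !eq_rshift eqxx eq_sym (negbTE ab).
Qed.

(** The distributive law for x_c f_ab = x_b f_ac - x_a f_bc. *)
Lemma F_pure_colon_split a b c (p : nat) (pk : p \in [pchar k]) :
    asteroidal_triple G a b c -> F_pure (pchar_binomial_edge_ring G pk) ->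
  exists q, [/\ avoiding_prod a * q \in J, avoiding_prod c * q \in J
               & avoiding_prod b * (x c * f a b - q) \in J].
Proof.
case=> _ [/avoiding_prod_binomial_in abJ /avoiding_prod_binomial_in bcJ
  /avoiding_prod_binomial_in acJ] pureA.
have pi0 q : (pi q == 0) = (q \in J).
  by rewrite -[0](raddf0 pi) -Quotient.idealrBE subr0.
pose D v := pi (avoiding_prod v).
pose r := pi (x b * f a c); pose s := - pi (x a * f b c).
have rs : pi (x c * f a b) = r + s.
  by rewrite /r /s -raddfB /=; congr pi; rewrite /edge_binomial; ring.
have colon0 v i j z :
    avoiding_prod v * f i j \in J -> D v * pi (x z * f i j) = 0.
  by move=> vJ; apply/eqP; rewrite -rmorphM pi0 mulrCA idealMr.
have [|||t [at0 bt ct0]] :=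
  @F_pure_annihilator_distr A p _ (D a) (D b) (D c) r s pureA.
- by rewrite /s mulrN (colon0 _ _ _ _ bcJ) oppr0.
- exact: colon0.
- by rewrite -rs; exact: colon0.
elim/quotW: t at0 bt ct0 => q at0 bt ct0; exists q; split; rewrite -pi0 rmorphM.
- exact/eqP.
- exact/eqP.
- by rewrite rmorphB /= rs; exact/eqP.
Qed.

Lemma connected_avoiding_ends w u v : connected_avoiding G w u v ->
  ~~ G u w /\ ~~ G v w.
Proof.
case=> s [_ <- _ /allP sN].
split; [have := sN u (mem_head _ _) | have := sN _ (mem_last u s)];
  by rewrite inE.
Qed.

Lemma asteroidal_triple_not_F_pure (p : nat) (pk : p \in [pchar k]) :
  has_asteroidal_triple G -> ~ F_pure (pchar_binomial_edge_ring G pk).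
Proof.
case=> a [b [c abcAT]] pureA.
have [q [qa qc qb]] := F_pure_colon_split abcAT pureA.
have [abc [/connected_avoiding_ends[Gac Gbc]]] := abcAT.
move=> /connected_avoiding_ends[].
rewrite ![G _ a]adj_sym => Gab _ _.
by have := colon_split_impossible abc Gab Gbc Gac qa qc; rewrite qb.
Qed.

End EdgeIdeal.

(** * The 6-cycle *)

Definition cycle6_adj : rel 'I_6 :=
  fun i j => (i.+1 %% 6 == j)%N || (j.+1 %% 6 == i)%N.

Fact cycle6_sym : ssrbool.symmetric cycle6_adj.
Proof. by move=> i j; rewrite /cycle6_adj orbC. Qed.

Fact cycle6_irr : irreflexive cycle6_adj.
Proof. by case=> [[|[|[|[|[|[|]]]]]] ?]. Qed.

Definition cycle6 : sgraph 6 := SGraph cycle6_sym cycle6_irr.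

Lemma cycle6_asteroidal : has_asteroidal_triple cycle6.
Proof.
pose v i : 'I_6 := inord i.
have vE i : (i < 6)%N -> v i = i :> nat by move=> ?; rewrite inordK.
exists (v 0%N), (v 2%N), (v 4%N); split.
  by rewrite /= !inE -!val_eqE /= !vE.
by split; [exists [:: v 1%N; v 2%N] | exists [:: v 3%N; v 4%N]
          | exists [:: v 5%N; v 4%N]];
  split; rewrite //= ?inE -?val_eqE /= /cycle6_adj ?vE.
Qed.
Local Close Scope ring_scope.

Theorem theorem2 :
  (forall (n : nat) (G : sgraph n), has_asteroidal_triple G ->
     forall (k : fieldType) (p : nat) (pk : p \in [pchar k]%R),
       ~ F_pure (pchar_binomial_edge_ring G pk)) /\
  ~ (forall (n : nat) (G : sgraph n), exists p0 : nat,
       forall (k : fieldType) (p : nat) (pk : p \in [pchar k]%R),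
         p0 < p -> F_pure (pchar_binomial_edge_ring G pk)).
Proof.
split=> [n G GAT k p pk | large]; first exact: asteroidal_triple_not_F_pure.
have [p0 pure_p0] := large 6 cycle6.
have [p p_gt p_prime] := prime_above p0.
have pk : p \in [pchar 'F_p]%R by rewrite pchar_Fp.
exact: (asteroidal_triple_not_F_pure cycle6_asteroidal (pure_p0 _ _ pk p_gt)).
Qed.
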